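(* Let $T$ and $T'$ be two relative Rota-Baxter operators of weight $1$ from a Lie-Yamaguti algebra $(\mathfrak h,[\cdot,\cdot]_{\mathfrak h},[\![\cdot,\cdot,\cdot]\!]_{\mathfrak h})$ to a Lie-Yamaguti algebra $(\mathfrak g,[\cdot,\cdot]_{\mathfrak g},[\![\cdot,\cdot,\cdot]\!]_{\mathfrak g})$ with respect to the same action $(\rho,\mu)$ of $\mathfrak g$ on $\mathfrak h$. Let $(\psi_{\mathfrak g},\psi_{\mathfrak h})$ be a homomorphism from $T'$ to $T$ such that $\psi_{\mathfrak h}$ is invertible. Define linear maps $p:\mathfrak C^n_{T'}(\mathfrak h,\mathfrak g)\to\mathfrak C^n_T(\mathfrak h,\mathfrak g)$ for $n\ge 1$ as follows. For $n=1$, $p(f)(v)=\psi_{\mathfrak g}(f(\psi_{\mathfrak h}^{-1}(v)))$. For $n\geq 2$, $p(f,g)=(p_{\rm I}(f),p_{\rm II}(g))$ with $$p_{\rm I}(f)(\mathfrak U_1,\dots,\mathfrak U_{n-1})=\psi_{\mathfrak g}\big(f(\psi_{\mathfrak h}^{-1}(\mathfrak U_1),\dots,\psi_{\mathfrak h}^{-1}(\mathfrak U_{n-1}))\big),$$ $$p_{\rm II}(g)(\mathfrak U_1,\dots,\mathfrak U_{n-1},v)=\psi_{\mathfrak g}\big(g(\psi_{\mathfrak h}^{-1}(\mathfrak U_1),\dots,\psi_{\mathfrak h}^{-1}(\mathfrak U_{n-1}),\psi_{\mathfrak h}^{-1}(v))\big),$$ where $\mathfrak U_k=u_k\wedge v_k\in\wedge^2\mathfrak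 h$, $\psi_{\mathfrak h}^{-1}(\mathfrak U_k)=\psi_{\mathfrak h}^{-1}(u_k)\wedge\psi_{\mathfrak h}^{-1}(v_k)$ and $v\in\mathfrak h$. Then $p$ is a cochain map from $\big(\bigoplus_{n\ge1}\mathfrak C^n_{T'}(\mathfrak h,\mathfrak g),\delta^{T'}\big)$ to $\big(\bigoplus_{n\ge1}\mathfrak C^n_{T}(\mathfrak h,\mathfrak g),\delta^{T}\big)$. Consequently, $p$ induces a homomorphism $p_*:\mathcal H^n_{T'}(\mathfrak h,\mathfrak g)\to\mathcal H^n_T(\mathfrak h,\mathfrak g)$ between cohomology groups.
   Context: All vector spaces are finite-dimensional over a field $\mathbb K$ of characteristic $0$. **Lie-Yamaguti algebra**: a vector space $\mathfrak g$ with a bilinear bracket $[\cdot,\cdot]:\wedge^2\mathfrak g\to\mathfrak g$ and a trilinear bracket $[\![\cdot,\cdot,\cdot]\!]:\wedge^2\mathfrak g\otimes\mathfrak g\to\mathfrak g$ (skew-symmetric in the first two arguments) such that for all $x,y,z,w,t$: (LY1) $[[x,y],z]+[[y,z],x]+[[z,x],y]+[\![x,y,z]\!]+[\![y,z,x]\!]+[\![z,x,y]\!]=0$; (LY2) $[\![[x,y],z,w]\!]+[\![[y,z],x,w]\!]+[\![[z,x],y,w]\!]=0$; (LY3) $[\![x,y,[z,w]]\!]=[[\![x,y,z]\!],w]+[z,[\![x,y,w]\!]]$; (LY4) $[\![x,y,[\![z,w,t]\!]]\!]=[\![[\![x,y,z]\!],w,t]\!]+[\![z,[\![x,y,w]\!],t]\!]+[\![z,w,[\![x,y,t]\!]]\!]$.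 A homomorphism of Lie-Yamaguti algebras is a linear map preserving both brackets. **Representation** of $\mathfrak g$: a vector space $V$ with linear $\rho:\mathfrak g\to\mathfrak{gl}(V)$ and bilinear $\mu:\otimes^2\mathfrak g\to\mathfrak{gl}(V)$ such that for all $x,y,z,w\in\mathfrak g$: $\mu([x,y],z)-\mu(x,z)\rho(y)+\mu(y,z)\rho(x)=0$; $\mu(x,[y,z])-\rho(y)\mu(x,z)+\rho(z)\mu(x,y)=0$; $\rho([\![x,y,z]\!])=[D(x,y),\rho(z)]$; $\mu(z,w)\mu(x,y)-\mu(y,w)\mu(x,z)-\mu(x,[\![y,z,w]\!])+D(y,z)\mu(x,w)=0$; $\mu([\![x,y,z]\!],w)+\mu(z,[\![x,y,w]\!])=[D(x,y),\mu(z,w)]$; where $D(x,y)=D_{\rho,\mu}(x,y):=\mu(y,x)-\mu(x,y)+[\rho(x),\rho(y)]-\rho([x,y])$. **Center** of a Lie-Yamaguti algebra $\mathfrak h$: $C(\mathfrak h)=\{x\in\mathfrak h: [x,y]=0,\ [\![x,y,z]\!]=0,\ [\![y,z,x]\!]=0\ \ \forall y,z\in\mathfrak h\}$. **Action** of $\mathfrak g$ on a Lie-Yamaguti algebra $(\mathfrak h,[\cdot,\cdot]_{\mathfrak h},[\![\cdot,\cdot,\cdot]\!]_{\mathfrak h})$: a pair $(\rho,\mu)$ such that $(\mathfrak h;\rho,\mu)$ is a representation of $\mathfrak g$ and for all $x,y\in\mathfrak g$, $u,v,w\in\mathfrak h$: $\rho(x)u,\ \mu(x,y)u\in C(\mathfrak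 h)$; $\rho(x)[u,v]_{\mathfrak h}=\mu(x,y)[u,v]_{\mathfrak h}=0$; $\rho(x)[\![u,v,w]\!]_{\mathfrak h}=\mu(x,y)[\![u,v,w]\!]_{\mathfrak h}=0$. **Relative Rota-Baxter operator of weight $1$** from $\mathfrak h$ to $\mathfrak g$ with respect to an action $(\rho,\mu)$ of $\mathfrak g$ on $\mathfrak h$: a linear map $T:\mathfrak h\to\mathfrak g$ such that for all $u,v,w\in\mathfrak h$ $[Tu,Tv]_{\mathfrak g}=T(\rho(Tu)v-\rho(Tv)u+[u,v]_{\mathfrak h})$, $[\![Tu,Tv,Tw]\!]_{\mathfrak g}=T(D(Tu,Tv)w+\mu(Tv,Tw)u-\mu(Tu,Tw)v+[\![u,v,w]\!]_{\mathfrak h})$. **Homomorphism from $T'$ to $T$**: a pair $(\psi_{\mathfrak g},\psi_{\mathfrak h})$ of Lie-Yamaguti algebra homomorphisms $\psi_{\mathfrak g}:\mathfrak g\to\mathfrak g$, $\psi_{\mathfrak h}:\mathfrak h\to\mathfrak h$ with $\psi_{\mathfrak g}\circ T'=T\circ\psi_{\mathfrak h}$, $\psi_{\mathfrak h}(\rho(x)u)=\rho(\psi_{\mathfrak g}(x))\psi_{\mathfrak h}(u)$, $\psi_{\mathfrak h}(\mu(x,y)u)=\mu(\psi_{\mathfrak g}(x),\psi_{\mathfrak g}(y))\psi_{\mathfrak h}(u)$ for all $x,y\in\mathfrak g$, $u\in\mathfrak h$. **Descent Lie-Yamaguti algebra** of $T$: the space $\mathfrak h$ with the Lie-Yamaguti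 algebra structure $[u,v]_T=\rho(Tu)v-\rho(Tv)u+[u,v]_{\mathfrak h}$, $[\![u,v,w]\!]_T=D(Tu,Tv)w+\mu(Tv,Tw)u-\mu(Tu,Tw)v+[\![u,v,w]\!]_{\mathfrak h}$. It has the representation $(\mathfrak g;\rho_T,\mu_T)$: $\rho_T(u)(x)=[Tu,x]_{\mathfrak g}+T(\rho(x)u)$, $\mu_T(u,v)(x)=[\![x,Tu,Tv]\!]_{\mathfrak g}-T(D(x,Tu)v-\mu(x,Tv)u)$, with $D_T(u,v)(x):=D_{\rho_T,\mu_T}(u,v)(x)=[\![Tu,Tv,x]\!]_{\mathfrak g}-T(\mu(Tv,x)u-\mu(Tu,x)v)$. **Cohomology of $T$**: cochains are $\mathfrak C^0_T(\mathfrak h,\mathfrak g)=\wedge^2\mathfrak g$, $\mathfrak C^1_T(\mathfrak h,\mathfrak g)=\mathrm{Hom}(\mathfrak h,\mathfrak g)$ and, for $n\ge1$, $\mathfrak C^{n+1}_T(\mathfrak h,\mathfrak g)=\mathrm{Hom}((\wedge^2\mathfrak h)^{\otimes n},\mathfrak g)\times\mathrm{Hom}((\wedge^2\mathfrak h)^{\otimes n}\otimes\mathfrak h,\mathfrak g)$. The coboundary $\partial$ is: on $\mathfrak C^0_T$, $\partial(x\wedge y)v=T(D(x,y)v)-[\![x,y,Tv]\!]_{\mathfrak g}$; on $\mathfrak C_T^m$ with $m\ge1$, $\partial=\delta^T=(\delta^T_{\rm I},\delta^T_{\rm II})$, where for $f\in\mathfrak C^1_T$ $\delta^T_{\rm I}(f)(u,v)=\rho_T(u)f(v)-\rho_T(v)f(u)-f([u,v]_T)$,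 $\delta^T_{\rm II}(f)(u,v,w)=D_T(u,v)f(w)+\mu_T(v,w)f(u)-\mu_T(u,w)f(v)-f([\![u,v,w]\!]_T)$, and for $(f,g)\in\mathfrak C^{n+1}_T$, $n\ge1$, $\mathfrak U_i=u_i\wedge v_i$, $w\in\mathfrak h$, $\delta^T_{\rm I}(f,g)(\mathfrak U_1,\dots,\mathfrak U_{n+1})=(-1)^n\big(\rho_T(u_{n+1})g(\mathfrak U_1,\dots,\mathfrak U_n,v_{n+1})-\rho_T(v_{n+1})g(\mathfrak U_1,\dots,\mathfrak U_n,u_{n+1})-g(\mathfrak U_1,\dots,\mathfrak U_n,[u_{n+1},v_{n+1}]_T)\big)+\sum_{k=1}^n(-1)^{k+1}D_T(\mathfrak U_k)f(\mathfrak U_1,\dots,\widehat{\mathfrak U_k},\dots,\mathfrak U_{n+1})+\sum_{1\le k<l\le n+1}(-1)^kf(\mathfrak U_1,\dots,\widehat{\mathfrak U_k},\dots,\mathfrak U_k\circ\mathfrak U_l,\dots,\mathfrak U_{n+1})$, $\delta^T_{\rm II}(f,g)(\mathfrak U_1,\dots,\mathfrak U_{n+1},w)=(-1)^n\big(\mu_T(v_{n+1},w)g(\mathfrak U_1,\dots,\mathfrak U_n,u_{n+1})-\mu_T(u_{n+1},w)g(\mathfrak U_1,\dots,\mathfrak U_n,v_{n+1})\big)+\sum_{k=1}^{n+1}(-1)^{k+1}D_T(\mathfrak U_k)g(\mathfrak U_1,\dots,\widehat{\mathfrak U_k},\dots,\mathfrak U_{n+1},w)+\sum_{1\le k<l\le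 n+1}(-1)^kg(\mathfrak U_1,\dots,\widehat{\mathfrak U_k},\dots,\mathfrak U_k\circ\mathfrak U_l,\dots,\mathfrak U_{n+1},w)+\sum_{k=1}^{n+1}(-1)^kg(\mathfrak U_1,\dots,\widehat{\mathfrak U_k},\dots,\mathfrak U_{n+1},[\![u_k,v_k,w]\!]_T)$, with $\mathfrak U_k\circ\mathfrak U_l=[\![u_k,v_k,u_l]\!]_T\wedge v_l+u_l\wedge[\![u_k,v_k,v_l]\!]_T$ (in the $l$-th place). These form a cochain complex; $\mathcal Z^n_T$, $\mathcal B^n_T$ are the $n$-cocycles and $n$-coboundaries, and $\mathcal H^n_T(\mathfrak h,\mathfrak g)=\mathcal Z^n_T/\mathcal B^n_T$ for $n\ge1$. The same definitions apply to $T'$. *)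

(* Defs.v *)
From HB Require Import structures.
From mathcomp Require Import all_boot all_algebra.
From mathcomp Require Import boolp functions.

Set Implicit Arguments.
Unset Strict Implicit.
Unset Printing Implicit Defensive.

Import GRing.Theory.
Local Open Scope ring_scope.
Local Open Scope quotient_scope.

Section Homology.

Variables (K : fieldType) (U V W : lmodType K).
Variables (d : {linear U -> V}) (e : {linear V -> W}).

Definition cocycle_pred : {pred V} := fun v => e v == 0.

Fact cocycle_pred_submod : submod_closed cocycle_pred.
Proof.
split=> [|a x y]; rewrite !unfold_in ?linear0 // => /eqP ex0 /eqP ey0.
by rewrite linearP ex0 ey0 scaler0 addr0.
Qed.

HB.instance Definition _ :=
  GRing.isSubmodClosed.Build K V cocycle_pred cocycle_pred_submod.

Record cocycle := Cocycle { cocycle_val : V; _ : cocycle_val \in cocycle_pred }.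

HB.instance Definition _ := [isSub for cocycle_val].
HB.instance Definition _ := [Choice of cocycle by <:].
HB.instance Definition _ := [SubChoice_isSubLmodule of cocycle by <:].

Definition coboundary_pred : {pred cocycle} :=
  fun z => `[< exists u, d u = val z >].

Fact coboundary_pred_submod : submod_closed coboundary_pred.
Proof.
split=> [|a x y]; first by apply/asboolP; exists 0; rewrite !linear0.
move=> /asboolP[u du] /asboolP[v dv]; apply/asboolP; exists (a *: u + v).
by rewrite linearP du dv linearP.
Qed.

HB.instance Definition _ :=
  GRing.isSubmodClosed.Build K cocycle coboundary_pred coboundary_pred_submod.

(* ker e / im d. The equation e \o d = 0 is not needed to form the quotient:
   two cocycles have the same class iff their difference is in im d. *)
Definition homology := Quotient.quot coboundary_pred.

HB.instance Definition _ := Choice.on homology.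
HB.instance Definition _ := GRing.Zmodule.on homology.

Definition homology_class (z : cocycle) : homology := \pi_homology z.

Definition homology_scale (a : K) (x : homology) : homology :=
  homology_class (a *: repr x).

Lemma homology_classP (x y : cocycle) :
  reflect (exists u, d u = val x - val y)
          (homology_class x == homology_class y).
Proof.
rewrite /homology_class -Quotient.idealrBE unfold_in.
by apply: (iffP (asboolP _)) => -[u du]; exists u; rewrite du linearB.
Qed.

Lemma homology_class_is_zmod : zmod_morphism homology_class.
Proof. by move=> x y; rewrite /homology_class !piE. Qed.

Lemma homology_scale_class (a : K) (z : cocycle) :
  homology_scale a (homology_class z) = homology_class (a *: z).
Proof.
apply/eqP/homology_classP.
have /homology_classP[u du] : homology_class (repr (homology_class z))
   == homology_class z by rewrite /homology_class reprK.
by exists (a *: u); rewrite linearZ /= du scalerBr !linearZ.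
Qed.

Lemma homology_ind (P : homology -> Prop) :
  (forall z, P (homology_class z)) -> forall x, P x.
Proof. by move=> Pz x; rewrite -[x]reprK; apply: Pz. Qed.

Fact homology_scalerA a b x :
  homology_scale a (homology_scale b x) = homology_scale (a * b) x.
Proof. by elim/homology_ind: x => z; rewrite !homology_scale_class scalerA. Qed.

Fact homology_scale1r : left_id 1 homology_scale.
Proof. by elim/homology_ind => z; rewrite homology_scale_class scale1r. Qed.

Let classD x y : homology_class (x + y) = homology_class x + homology_class y.
Proof. by rewrite /homology_class !piE. Qed.

Fact homology_scalerDr : right_distributive homology_scale +%R.
Proof.
move=> a; elim/homology_ind => x; elim/homology_ind => y.
by rewrite -classD !homology_scale_class scalerDr classD.
Qed.

Fact homology_scalerDl v : {morph homology_scale^~ v : a b / a + b}.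
Proof.
move=> a b; elim/homology_ind: v => x.
by rewrite !homology_scale_class scalerDl classD.
Qed.

HB.instance Definition _ := GRing.Zmodule_isLmodule.Build K homology
  homology_scalerA homology_scale1r homology_scalerDr homology_scalerDl.

Fact homology_class_is_linear : linear homology_class.
Proof. by move=> a x y; rewrite classD -homology_scale_class. Qed.

HB.instance Definition _ :=
  GRing.isLinear.Build K cocycle homology _ homology_class homology_class_is_linear.

End Homology.

Section Multilinear.

Variable K : fieldType.
Implicit Types U V W X : lmodType K.

Definition bilin U V W (f : U -> V -> W) : Prop :=
  (forall v, linear (f^~ v)) /\ (forall u, linear (f u)).

Definition trilin U V W X (f : U -> V -> W -> X) : Prop :=
  [/\ forall v w, linear (fun u => f u v w),
      forall u w, linear (fun v => f u v w)
    & forall u v, linear (f u v)].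

Lemma lin_add V W (f g : V -> W) :
  linear f -> linear g -> linear (fun x => f x + g x).
Proof. by move=> lf lg a x y; rewrite lf lg scalerDr addrACA. Qed.

Lemma lin_scale V W k (f : V -> W) : linear f -> linear (fun x => k *: f x).
Proof. by move=> lf a x y; rewrite lf scalerDr !scalerA mulrC. Qed.

Lemma lin_opp V W (f : V -> W) : linear f -> linear (fun x => - f x).
Proof. by move=> lf a x y; rewrite lf opprD scalerN. Qed.

Lemma lin_sum V W (I : Type) (r : seq I) (P : pred I) (f : I -> V -> W) :
  (forall i, P i -> linear (f i)) -> linear (fun x => \sum_(i <- r | P i) f i x).
Proof.
move=> lf a x y; rewrite scaler_sumr -big_split /=.
by apply: eq_bigr => i Pi; rewrite lf.
Qed.

Lemma lin_comp U V W (f : V -> W) (g : U -> V) :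
  linear f -> linear g -> linear (fun x => f (g x)).
Proof. by move=> lf lg a x y; rewrite lg lf. Qed.

Lemma lin_id V : linear (fun x : V => x). Proof. by []. Qed.

Lemma lin0 V W (f : V -> W) : linear f -> f 0 = 0.
Proof. by move=> lf; have := lf (-1) 0 0; rewrite !scaler0 addr0 scaleN1r addNr. Qed.

End Multilinear.

Section ExteriorSquare.

Variables (K : fieldType) (V : vectType K).

Local Notation d := (\dim {:V}).
Local Notation e := (vbasis {:V}).

(* The exterior square of V in coordinates with respect to e_i /\ e_j, i < j.
   Its universal property is given by wedge_liftE and wedge_span. *)
Definition wedge_index : finType := {ij : 'I_d * 'I_d | (ij.1 < ij.2)%N}.
Definition wedge2 := {ffun wedge_index -> K^o}.

HB.instance Definition _ := GRing.Lmodule.on wedge2.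

Definition wedge (x y : V) : wedge2 :=
  [ffun p => coord e (val p).1 x * coord e (val p).2 y
             - coord e (val p).2 x * coord e (val p).1 y].

Definition wedge_lift (W : lmodType K) (b : V -> V -> W) (w : wedge2) : W :=
  \sum_p w p *: b e`_(val p).1 e`_(val p).2.

Lemma wedge_lift_linear (W : lmodType K) (b : V -> V -> W) :
  linear (wedge_lift b).
Proof.
move=> a x y; rewrite /wedge_lift scaler_sumr -big_split /=.
by apply: eq_bigr => p _; rewrite !ffunE scalerDl scalerA.
Qed.

Lemma wedge_liftE (W : lmodType K) (b : V -> V -> W) :
  bilin b -> (forall x, b x x = 0) ->
  forall x y, wedge_lift b (wedge x y) = b x y.
Proof.
move=> [bl br] b0 x y.
have bN u v : b u v = - b v u.
  have lD w : {morph b^~ w : p q / p + q} by move=> p q; have := bl w 1 p q; rewrite !scale1r.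
  have rD w : {morph b w : p q / p + q} by move=> p q; have := br w 1 p q; rewrite !scale1r.
  apply/eqP; rewrite -addr_eq0; apply/eqP.
  by have := b0 (u + v); rewrite lD !rD !b0 add0r addr0.
pose X i := coord e i x; pose Y i := coord e i y.
pose B (i j : 'I_d) := b e`_i e`_j.
have bE : b x y = \sum_(p : 'I_d * 'I_d) (X p.1 * Y p.2) *: B p.1 p.2.
  pose bL v : {linear V -> W} :=
    HB.pack (b^~ v) (GRing.isLinear.Build K V W _ (b^~ v) (bl v)).
  pose bR u : {linear V -> W} :=
    HB.pack (b u) (GRing.isLinear.Build K V W _ (b u) (br u)).
  rewrite -(pair_bigA _ (fun i j => (X i * Y j) *: B i j)) /=.
  rewrite {1}(coord_vbasis (memvf x)) -[LHS]/(bL y _) linear_sum /=.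
  apply: eq_bigr => i _; rewrite -[LHS]/(bL y _) linearZ /=.
  rewrite {1}(coord_vbasis (memvf y)) -[b _ _]/(bR _ _) linear_sum scaler_sumr.
  by apply: eq_bigr => j _; rewrite linearZ /= scalerA.
pose F (p : 'I_d * 'I_d) := (X p.1 * Y p.2 - X p.2 * Y p.1) *: B p.1 p.2.
transitivity (\sum_(p : 'I_d * 'I_d | (p.1 < p.2)%N) F p).
  rewrite (big_sub (fun p : 'I_d * 'I_d => (p.1 < p.2)%N) F).
  by apply: eq_bigr => p _; rewrite ffunE.
rewrite bE [RHS](bigID (fun p : 'I_d * 'I_d => (p.1 < p.2)%N)) /=.
rewrite [X in _ = _ + X](bigID (fun p : 'I_d * 'I_d => (p.2 < p.1)%N)) /=.
rewrite [X in _ = _ + (_ + X)]big1 ?addr0; last first.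
  move=> [i j] /=; rewrite -!leqNgt => /andP[ij ji].
  have -> : i = j by apply/val_inj/anti_leq; rewrite ij ji.
  by rewrite /B b0 scaler0.
rewrite [X in _ = _ + X](reindex_inj (h := fun p : 'I_d * 'I_d => (p.2, p.1))) /=;
  last by move=> [? ?] [? ?] [-> ->].
rewrite [X in _ = _ + X](eq_bigl (fun p : 'I_d * 'I_d => (p.1 < p.2)%N)); last first.
  by move=> [i j] /=; case: ltngtP.
rewrite -big_split /=; apply: eq_bigr => -[i j] _ /=.
by rewrite /F /= /B (bN e`_j) scalerN scalerBl.
Qed.

Lemma wedge_span (w : wedge2) : wedge_lift wedge w = w.
Proof.
have fe : free e by apply/basis_free/vbasisP.
apply/ffunP => q; rewrite /wedge_lift sum_ffunE (bigD1 q) //= big1 ?addr0.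
  rewrite !ffunE !(coord_free _ _ fe) !eqxx; case: q => -[i j] /= ij.
  by rewrite -!val_eqE /= ?(gtn_eqF ij) ?(ltn_eqF ij) mul0r subr0 mulr1 [_ *: _]mulr1.
move=> p npq; rewrite !ffunE !(coord_free _ _ fe).
case: p q npq => -[i j] /= ij [[k l] /= kl]; rewrite -val_eqE /= => npq.
have -> : (i == k)%:R * (j == l)%:R = 0 :> K.
  by move: npq; rewrite xpair_eqE; do 2!case: eqP => _ //=; rewrite ?mulr0 ?mul0r.
have -> : (i == l)%:R * (j == k)%:R = 0 :> K.
  case: eqP => [il|]; last by rewrite mul0r.
  case: eqP => [jk|]; last by rewrite mulr0.
  by move: ij; rewrite il jk ltnNge ltnW.
by rewrite subrr scaler0.
Qed.

End ExteriorSquare.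

Section Cochains.

Variable K : fieldType.
Implicit Types V W : lmodType K.

(* upd U i x replaces the i-th entry of U by x, hat U k removes the k-th entry. *)
Definition upd n (X : Type) (U : 'I_n -> X) (i : 'I_n) (x : X) : 'I_n -> X :=
  fun j => if j == i then x else U j.

Definition hat n (X : Type) (U : 'I_n.+1 -> X) (k : 'I_n.+1) : 'I_n -> X :=
  fun j => U (lift k j).

Definition bialt V W (F : V * V -> W) : Prop :=
  [/\ forall v, linear (fun u => F (u, v)), forall u, linear (fun v => F (u, v))
    & forall u, F (u, u) = 0].

Definition multialt n V W (f : ('I_n -> V * V) -> W) : Prop :=
  forall U i, bialt (fun x => f (upd U i x)).

Section Spaces.

Variables (n : nat) (V W : lmodType K).

(* Hom((wedge^2 V)^{(x) n}, W): functions of n pairs of vectors, bilinear and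
   alternating in each pair; the value at U is the value of the linear map at
   U_1 (x) ... (x) U_n, where U_i = (U i).1 /\ (U i).2. *)
Definition cochainI_pred : {pred ('I_n -> V * V) -> W} :=
  fun f => `[< multialt f >].

Fact cochainI_submod : submod_closed cochainI_pred.
Proof.
split=> [|a f g /asboolP mf /asboolP mg]; apply/asboolP.
  by move=> U i; split=> // *; rewrite /GRing.zero /= => b ? ?; rewrite scaler0 addr0.
move=> U i; have [f1 f2 f0] := mf U i; have [g1 g2 g0] := mg U i; split.
- by move=> v; apply: lin_add => //; apply: lin_scale.
- by move=> u; apply: lin_add => //; apply: lin_scale.
by move=> u; rewrite -[LHS]/(a *: f _ + g _) f0 g0 scaler0 addr0.
Qed.

HB.instance Definition _ :=
  GRing.isSubmodClosed.Build K (('I_n -> V * V) -> W) cochainI_pred cochainI_submod.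

Record cochainI :=
  CochainI { cochainI_val :> ('I_n -> V * V) -> W;
             _ : cochainI_val \in cochainI_pred }.

HB.instance Definition _ := [isSub for cochainI_val].
HB.instance Definition _ := [Choice of cochainI by <:].
HB.instance Definition _ := [SubChoice_isSubLmodule of cochainI by <:].

(* Hom((wedge^2 V)^{(x) n} (x) V, W) *)
Definition cochainII_pred : {pred ('I_n -> V * V) -> V -> W} :=
  fun g => `[< (forall w, multialt (g^~ w)) /\ (forall U, linear (g U)) >].

Fact cochainII_submod : submod_closed cochainII_pred.
Proof.
split=> [|a f g /asboolP[mf lf] /asboolP[mg lg]]; apply/asboolP; split.
- by move=> w U i; split=> // *; rewrite /GRing.zero /= => b ? ?; rewrite scaler0 addr0.
- by move=> U b u v; rewrite -[LHS]/0 -[X in _ *: X + X]/0 scaler0 addr0.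
- move=> w U i; have [f1 f2 f0] := mf w U i; have [g1 g2 g0] := mg w U i; split.
  + by move=> v; apply: lin_add => //; apply: lin_scale.
  + by move=> u; apply: lin_add => //; apply: lin_scale.
  + by move=> u; rewrite -[LHS]/(a *: f _ _ + g _ _) f0 g0 scaler0 addr0.
by move=> U; apply: lin_add => //; apply: lin_scale.
Qed.

HB.instance Definition _ :=
  GRing.isSubmodClosed.Build K (('I_n -> V * V) -> V -> W) cochainII_pred
    cochainII_submod.

Record cochainII :=
  CochainII { cochainII_val :> ('I_n -> V * V) -> V -> W;
              _ : cochainII_val \in cochainII_pred }.

HB.instance Definition _ := [isSub for cochainII_val].
HB.instance Definition _ := [Choice of cochainII by <:].
HB.instance Definition _ := [SubChoice_isSubLmodule of cochainII by <:].

Lemma cochainIP (f : cochainI) : multialt f.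
Proof. exact/asboolP/(valP f). Qed.

Lemma cochainIIP (g : cochainII) w : multialt (g^~ w).
Proof. by have /asboolP[] := valP g. Qed.

Lemma cochainII_linear (g : cochainII) U : linear (g U).
Proof. by have /asboolP[] := valP g. Qed.

End Spaces.

Lemma bialt_ext V W (F G : V * V -> W) : F =1 G -> bialt G -> bialt F.
Proof. by move=> /funext ->. Qed.

Lemma bialt_add V W (F G : V * V -> W) :
  bialt F -> bialt G -> bialt (fun x => F x + G x).
Proof.
move=> [f1 f2 f0] [g1 g2 g0]; split=> [v|u|u]; try exact: lin_add.
by rewrite f0 g0 addr0.
Qed.

Lemma bialt_comp V W W' (phi : W -> W') (F : V * V -> W) :
  linear phi -> bialt F -> bialt (fun x => phi (F x)).
Proof.
move=> lphi [f1 f2 f0]; split=> [v|u|u]; try exact: (lin_comp lphi).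
by rewrite f0 lin0.
Qed.

Lemma bialt_opp V W (F : V * V -> W) : bialt F -> bialt (fun x => - F x).
Proof. by apply: (bialt_comp (phi := -%R)); apply/lin_opp/lin_id. Qed.

Lemma bialt_scale V W k (F : V * V -> W) : bialt F -> bialt (fun x => k *: F x).
Proof. by apply: (bialt_comp (phi := *:%R k)); apply/lin_scale/lin_id. Qed.

Lemma bialt_sum V W (I : Type) (r : seq I) (P : pred I) (F : I -> V * V -> W) :
  (forall i, P i -> bialt (F i)) -> bialt (fun x => \sum_(i <- r | P i) F i x).
Proof.
move=> bF; split=> [v|u|u].
- by apply: lin_sum => i /bF[].
- by apply: lin_sum => i /bF[].
by rewrite big1 // => i /bF[].
Qed.

(* The derivation of /\^2 induced by an endomorphism. *)
Lemma bialt_deriv V W (F : V * V -> W) (phi : V -> V) : linear phi -> bialt F ->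
  bialt (fun x => F (phi x.1, x.2) + F (x.1, phi x.2)).
Proof.
move=> lphi [f1 f2 f0]; split=> [v|u|u] /=.
- by apply: lin_add; [exact: (lin_comp (f1 _)) | exact: f1].
- by apply: lin_add; [exact: f2 | exact: (lin_comp (f2 _))].
have /= := f0 (phi u + u).
have fl p q w : F (p + q, w) = F (p, w) + F (q, w).
  by have := f1 w 1 p q; rewrite !scale1r.
have fr p q w : F (w, p + q) = F (w, p) + F (w, q).
  by have := f2 w 1 p q; rewrite !scale1r.
by rewrite fl !fr !f0 add0r addr0.
Qed.

Section Upd.

Variables (n : nat) (X : Type) (U : 'I_n.+1 -> X).

Lemma upd_eq i x : upd U i x i = x. Proof. by rewrite /upd eqxx. Qed.

Lemma upd_neq i j x : j != i -> upd U i x j = U j.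
Proof. by rewrite /upd => /negPf ->. Qed.

Lemma upd_updE i x y : upd (upd U i x) i y = upd U i y.
Proof. by apply/funext => j; rewrite /upd; case: eqP. Qed.

Lemma upd_updC i j x y :
  i != j -> upd (upd U i x) j y = upd (upd U j y) i x.
Proof.
move=> ij; apply/funext => k; rewrite /upd.
by case: eqP => // ->; rewrite eq_sym (negPf ij).
Qed.

Lemma hat_updE k x : hat (upd U k x) k = hat U k.
Proof. by apply/funext => j; rewrite /hat upd_neq // eq_sym neq_lift. Qed.

Lemma hat_upd_lift k j x : hat (upd U (lift k j) x) k = upd (hat U k) j x.
Proof. by apply/funext => i; rewrite /hat /upd (inj_eq lift_inj). Qed.

End Upd.

End Cochains.

Section Coboundary.

Variable K : fieldType.

Definition Dop (V W : lmodType K) (br : V -> V -> V) (rho : V -> W -> W)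
    (mu : V -> V -> W -> W) (x y : V) (w : W) : W :=
  mu y x w - mu x y w + (rho x (rho y w) - rho y (rho x w)) - rho (br x y) w.

(* The multilinear data entering the coboundary formulas. *)
Record lyData (h g : vectType K) := LyData {
  d_br : h -> h -> h;
  d_tr : h -> h -> h -> h;
  d_rho : h -> g -> g;
  d_mu : h -> h -> g -> g;
  d_br_bilin : bilin d_br;
  d_br_alt : forall u, d_br u u = 0;
  d_tr_trilin : trilin d_tr;
  d_tr_alt : forall u v, d_tr u u v = 0;
  d_rho_bilin : bilin d_rho;
  d_mu_trilin : trilin d_mu
}.

Variables (h g : vectType K) (A : lyData h g).

Local Notation br := (d_br A).
Local Notation tr := (d_tr A).
Local Notation rho := (d_rho A).
Local Notation mu := (d_mu A).
Local Notation D := (Dop br rho mu).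
Local Notation CI n := (cochainI n h g).
Local Notation CII n := (cochainII n h g).
Local Notation pairs n := ('I_n -> h * h).

Definition delta1_I_raw (f : 'Hom(h, g)) (U : pairs 1) : g :=
  let u := (U ord0).1 in let v := (U ord0).2 in
  rho u (f v) - rho v (f u) - f (br u v).

Definition delta1_II_raw (f : 'Hom(h, g)) (U : pairs 1) (w : h) : g :=
  let u := (U ord0).1 in let v := (U ord0).2 in
  D u v (f w) + mu v w (f u) - mu u w (f v) - f (tr u v w).

(* U with U_k \o U_l in place l and U_k removed; as U_k \o U_l is the sum of two
   decomposable bivectors, there are two terms. *)
Definition circ1 n (U : pairs n.+1) (k l : 'I_n.+1) : pairs n :=
  hat (upd U l (tr (U k).1 (U k).2 (U l).1, (U l).2)) k.

Definition circ2 n (U : pairs n.+1) (k l : 'I_n.+1) : pairs n :=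
  hat (upd U l ((U l).1, tr (U k).1 (U k).2 (U l).2)) k.

(* Indices start at 0, so that the sign (-1)^k of the usual formula, where
   1 <= k <= n + 1, is written (-1)^(k + 1) here. *)
Definition delta_I_raw n (f : CI n) (p : CII n) (U : pairs n.+1) : g :=
  let u := (U ord_max).1 in let v := (U ord_max).2 in
  let U' := hat U ord_max in
  (-1) ^+ n *: (rho u (p U' v) - rho v (p U' u) - p U' (br u v))
  + \sum_(k < n.+1 | (k < n)%N) (-1) ^+ k *: D (U k).1 (U k).2 (f (hat U k))
  + \sum_(k < n.+1) \sum_(l < n.+1 | (k < l)%N)
      (-1) ^+ k.+1 *: (f (circ1 U k l) + f (circ2 U k l)).

Definition delta_II_raw n (p : CII n) (U : pairs n.+1) (w : h) : g :=
  let u := (U ord_max).1 in let v := (U ord_max).2 in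
  let U' := hat U ord_max in
  (-1) ^+ n *: (mu v w (p U' u) - mu u w (p U' v))
  + \sum_(k < n.+1) (-1) ^+ k *: D (U k).1 (U k).2 (p (hat U k) w)
  + \sum_(k < n.+1) \sum_(l < n.+1 | (k < l)%N)
      (-1) ^+ k.+1 *: (p (circ1 U k l) w + p (circ2 U k l) w)
  + \sum_(k < n.+1) (-1) ^+ k.+1 *: p (hat U k) (tr (U k).1 (U k).2 w).

Let rho1 := (d_rho_bilin A).1.
Let rho2 := (d_rho_bilin A).2.
Let br1 := (d_br_bilin A).1.
Let br2 := (d_br_bilin A).2.
Let mu1 v w : linear (fun u => mu u v w). Proof. by case: (d_mu_trilin A). Qed.
Let mu2 u w : linear (fun v => mu u v w). Proof. by case: (d_mu_trilin A). Qed.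
Let mu3 u v : linear (mu u v). Proof. by case: (d_mu_trilin A). Qed.
Let tr1 v w : linear (fun u => tr u v w). Proof. by case: (d_tr_trilin A). Qed.
Let tr2 u w : linear (fun v => tr u v w). Proof. by case: (d_tr_trilin A). Qed.
Let tr3 u v : linear (tr u v). Proof. by case: (d_tr_trilin A). Qed.

Lemma Dop_linear u v : linear (D u v).
Proof.
rewrite /Dop; apply: lin_add; last by apply/lin_opp/rho2.
apply: lin_add; first by apply: lin_add; [|apply: lin_opp]; apply: mu3.
by apply: lin_add; [|apply: lin_opp]; apply: lin_comp; apply: rho2.
Qed.

Lemma Dop_bialt w : bialt (fun x => D x.1 x.2 w).
Proof.
split=> [v|u|u] /=; rewrite /Dop.
- apply: lin_add; last by apply/lin_opp/(lin_comp (rho1 w))/br1.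
  apply: lin_add; first by apply: lin_add; [exact: mu2 | apply/lin_opp/mu1].
  apply: lin_add; first exact: rho1.
  by apply/lin_opp/(lin_comp (rho2 v)).
- apply: lin_add; last by apply/lin_opp/(lin_comp (rho1 w))/br2.
  apply: lin_add; first by apply: lin_add; [exact: mu1 | apply/lin_opp/mu2].
  apply: lin_add; last by apply/lin_opp/rho1.
  exact: (lin_comp (rho2 u)).
by rewrite d_br_alt !subrr (lin0 (rho1 w)) subr0 addr0.
Qed.

Lemma partI_bialt (G : h -> g) : linear G ->
  bialt (fun x => rho x.1 (G x.2) - rho x.2 (G x.1) - G (br x.1 x.2)).
Proof.
move=> lG; split=> [v|u|u] /=.
- apply: lin_add; last by apply/lin_opp/(lin_comp lG).
  apply: lin_add; [exact: rho1 | apply/lin_opp/(lin_comp (rho2 v) lG)].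
- apply: lin_add; last by apply/lin_opp/(lin_comp lG).
  apply: lin_add; [exact: (lin_comp (rho2 u) lG) | exact/lin_opp/rho1].
by rewrite subrr d_br_alt (lin0 lG) subr0.
Qed.

Lemma partII_bialt (G : h -> g) w : linear G ->
  bialt (fun x => mu x.2 w (G x.1) - mu x.1 w (G x.2)).
Proof.
move=> lG; split=> [v|u|u] /=; last by rewrite subrr.
- by apply: lin_add; [exact: (lin_comp (mu3 v w) lG) | apply/lin_opp/mu1].
by apply: lin_add; [exact: mu1 | exact/lin_opp/(lin_comp (mu3 u w) lG)].
Qed.

Lemma tr_bialt w : bialt (fun x => tr x.1 x.2 w).
Proof.
by split=> [v|u|u] /=; [exact: tr1 | exact: tr2 | exact: d_tr_alt].
Qed.

Lemma circ_bialt n (f : pairs n -> g) (U : pairs n.+1) (i k l : 'I_n.+1) :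
  multialt f -> k != l ->
  bialt (fun x => f (circ1 (upd U i x) k l) + f (circ2 (upd U i x) k l)).
Proof.
move=> mf kl; rewrite /circ1 /circ2.
have [l' lE] : {l' | l = lift k l'} by case: (unliftP k l) kl => [j ->|->]; [exists j | rewrite eqxx].
have [->|ik] := eqVneq i k.
  rewrite lE; apply: (@bialt_ext _ _ _ _
    (fun x => f (upd (hat U k) l' (tr x.1 x.2 (U l).1, (U l).2))
            + f (upd (hat U k) l' ((U l).1, tr x.1 x.2 (U l).2)))).
    move=> x; rewrite upd_eq -lE (upd_neq _ _ (j := l)); last by rewrite eq_sym.
    by rewrite !(upd_updC _ _ _ kl) !hat_updE lE !hat_upd_lift.
  have [f1 f2 _] := mf (hat U k) l'.
  by apply: bialt_add; [apply: (bialt_comp (f1 _)) | apply: (bialt_comp (f2 _))];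
     apply: tr_bialt.
have [->|il] := eqVneq i l.
  apply: (@bialt_ext _ _ _ _
    (fun x => f (upd (hat U k) l' (tr (U k).1 (U k).2 x.1, x.2))
            + f (upd (hat U k) l' (x.1, tr (U k).1 (U k).2 x.2)))).
    by move=> x; rewrite upd_eq upd_neq // !upd_updE lE !hat_upd_lift.
  exact: (bialt_deriv (tr3 _ _) (mf (hat U k) l')).
have [i' iE] : {i' | i = lift k i'}.
  by case: (unliftP k i) ik => [j ->|->]; [exists j | rewrite eqxx].
apply: (@bialt_ext _ _ _ _
  (fun x => f (upd (hat (upd U l (tr (U k).1 (U k).2 (U l).1, (U l).2)) k) i' x)
          + f (upd (hat (upd U l ((U l).1, tr (U k).1 (U k).2 (U l).2)) k) i' x))).
  move=> x; rewrite !(upd_neq _ _ (i := i)) 1?eq_sym //.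
  by rewrite !(upd_updC _ _ _ il) iE !hat_upd_lift.
by apply: bialt_add; apply: mf.
Qed.

Lemma hat_bialt n (f : pairs n -> g) (U : pairs n.+1) (i k : 'I_n.+1) :
  multialt f -> i != k -> bialt (fun x => f (hat (upd U i x) k)).
Proof.
move=> mf; case: (unliftP k i) => [j ->|->]; last by rewrite eqxx.
by move=> _; apply: (bialt_ext _ (mf (hat U k) j)) => x; rewrite hat_upd_lift.
Qed.

Lemma pair_bialt n (F : h * h -> pairs n -> g) (U : pairs n.+1) (i k : 'I_n.+1) :
  (forall V, bialt (F^~ V)) -> (forall x, multialt (F x)) ->
  bialt (fun x => F (upd U i x k) (hat (upd U i x) k)).
Proof.
move=> F1 F2; have [->|ik] := eqVneq i k.
  by apply: (bialt_ext _ (F1 (hat U k))) => x; rewrite upd_eq hat_updE.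
apply: (bialt_ext _ (hat_bialt U (F2 (U k)) ik)) => x.
by rewrite upd_neq // eq_sym.
Qed.

Fact delta1_I_subproof f : delta1_I_raw f \in @cochainI_pred K 1 h g.
Proof.
apply/asboolP => U i; rewrite /delta1_I_raw [i]ord1.
have lf : linear f by exact: linearP.
by apply: (bialt_ext _ (partI_bialt lf)) => x; rewrite upd_eq.
Qed.

Fact delta1_II_subproof f : delta1_II_raw f \in @cochainII_pred K 1 h g.
Proof.
have lf : linear f by exact: linearP.
apply/asboolP; split=> [w U i|U]; rewrite /delta1_II_raw.
  rewrite [i]ord1.
  apply: (@bialt_ext _ _ _ _ (fun x => D x.1 x.2 (f w) +
    (mu x.2 w (f x.1) - mu x.1 w (f x.2)) - f (tr x.1 x.2 w))).
    by move=> x; rewrite upd_eq addrA.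
  apply: bialt_add; last by apply/bialt_opp/(bialt_comp lf)/tr_bialt.
  by apply: bialt_add; [apply: Dop_bialt | apply: partII_bialt].
apply: lin_add; last by apply/lin_opp/(lin_comp lf)/tr3.
apply: lin_add; last by apply/lin_opp/mu2.
by apply: lin_add; [apply/(lin_comp _ lf)/Dop_linear | apply: mu2].
Qed.

Fact delta_I_subproof n (f : CI n) (p : CII n) :
  delta_I_raw f p \in @cochainI_pred K n.+1 h g.
Proof.
apply/asboolP => U i; rewrite /delta_I_raw.
apply: bialt_add; first apply: bialt_add.
- apply: bialt_scale.
  apply: (pair_bialt (F := fun x V => rho x.1 (p V x.2) - rho x.2 (p V x.1)
    - p V (br x.1 x.2))) => [V|x].
    exact/partI_bialt/cochainII_linear.
  move=> V j; apply: bialt_add; last by apply/bialt_opp/cochainIIP.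
  apply: bialt_add; last apply: bialt_opp;
    by apply: (bialt_comp (rho2 _)); apply: cochainIIP.
- apply: bialt_sum => k _; apply: bialt_scale.
  apply: (pair_bialt (F := fun x V => D x.1 x.2 (f V))) => [V|x].
    exact: Dop_bialt.
  by move=> V j; apply/(bialt_comp (Dop_linear _ _))/cochainIP.
apply: bialt_sum => k _; apply: bialt_sum => l kl; apply: bialt_scale.
apply: circ_bialt; first exact: cochainIP.
by apply: contraTN kl => /eqP->; rewrite ltnn.
Qed.

Fact delta_II_subproof n (p : CII n) :
  delta_II_raw p \in @cochainII_pred K n.+1 h g.
Proof.
apply/asboolP; split=> [w U i|U]; rewrite /delta_II_raw.
  apply: bialt_add; first apply: bialt_add; first apply: bialt_add.
  - apply: bialt_scale.
    apply: (pair_bialt (F := fun x V => mu x.2 w (p V x.1) - mu x.1 w (p V x.2))) => [V|x].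
      exact/partII_bialt/cochainII_linear.
    by move=> V j; apply: bialt_add; [|apply: bialt_opp];
      apply: (bialt_comp (mu3 _ _)); apply: cochainIIP.
  - apply: bialt_sum => k _; apply: bialt_scale.
    apply: (pair_bialt (F := fun x V => D x.1 x.2 (p V w))) => [V|x].
      exact: Dop_bialt.
    by move=> V j; apply/(bialt_comp (Dop_linear _ _))/cochainIIP.
  - apply: bialt_sum => k _; apply: bialt_sum => l kl; apply: bialt_scale.
    apply: (circ_bialt (f := p^~ w)); first exact: cochainIIP.
    by apply: contraTN kl => /eqP->; rewrite ltnn.
  apply: bialt_sum => k _; apply: bialt_scale.
  apply: (pair_bialt (F := fun x V => p V (tr x.1 x.2 w))) => [V|x].
    by apply: (bialt_comp (cochainII_linear p V)); apply: tr_bialt.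
  by move=> V j; apply: cochainIIP.
have lp := cochainII_linear p.
apply: lin_add; first apply: lin_add; first apply: lin_add.
- by apply: lin_scale; apply: lin_add; [exact: mu2 | exact/lin_opp/mu2].
- by apply: lin_sum => k _; apply/lin_scale/(lin_comp (Dop_linear _ _))/lp.
- by apply: lin_sum => k _; apply: lin_sum => l _; apply/lin_scale/lin_add; apply: lp.
by apply: lin_sum => k _; apply/lin_scale/(lin_comp (lp _))/tr3.
Qed.

Definition delta1 (f : 'Hom(h, g)) : (CI 1 * CII 1)%type :=
  (CochainI (delta1_I_subproof f), CochainII (delta1_II_subproof f)).

Definition deltaS n (c : (CI n * CII n)%type) : (CI n.+1 * CII n.+1)%type :=
  (CochainI (delta_I_subproof c.1 c.2), CochainII (delta_II_subproof c.2)).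

Lemma delta1_linear : linear delta1.
Proof.
move=> a f f'; congr pair; apply/val_inj/funext => U /=.
  set F := fun f => delta1_I_raw f U; apply: (_ : linear F).
  have ev v : linear (fun f : 'Hom(h, g) => f v) by move=> b p q; rewrite /= add_lfunE scale_lfunE.
  rewrite /F /delta1_I_raw /=; apply: lin_add; last exact/lin_opp/ev.
  by apply: lin_add; [|apply: lin_opp]; apply: (lin_comp (rho2 _)); apply: ev.
apply/funext => w; set F := fun f => delta1_II_raw f U w; apply: (_ : linear F).
have ev v : linear (fun f : 'Hom(h, g) => f v) by move=> b p q; rewrite /= add_lfunE scale_lfunE.
rewrite /F /delta1_II_raw /=; apply: lin_add; last exact/lin_opp/ev.
apply: lin_add; last by apply/lin_opp/(lin_comp (mu3 _ _))/ev.
by apply: lin_add; [apply/(lin_comp (Dop_linear _ _))/ev | apply/(lin_comp (mu3 _ _))/ev].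
Qed.

Lemma deltaS_linear n : linear (@deltaS n).
Proof.
move=> a c c'.
have evI V : linear (fun c : (CI n * CII n)%type => c.1 V) by [].
have evII V w : linear (fun c : (CI n * CII n)%type => c.2 V w) by [].
congr pair; apply/val_inj/funext => U /=.
  pose F (c : (CI n * CII n)%type) := delta_I_raw c.1 c.2 U; apply: (_ : linear F).
  rewrite /F /delta_I_raw; apply: lin_add; first apply: lin_add.
  - apply/lin_scale/lin_add; last exact/lin_opp/evII.
    by apply: lin_add; [|apply: lin_opp]; apply/(lin_comp (rho2 _))/evII.
  - by apply: lin_sum => k _; apply/lin_scale/(lin_comp (Dop_linear _ _))/evI.
  by apply: lin_sum => k _; apply: lin_sum => l _; apply/lin_scale/lin_add; apply: evI.
apply/funext => w; pose F (c : (CI n * CII n)%type) := delta_II_raw c.2 U w; apply: (_ : linear F).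
rewrite /F /delta_II_raw; apply: lin_add; first apply: lin_add; first apply: lin_add.
- by apply/lin_scale/lin_add; [|apply: lin_opp]; apply/(lin_comp (mu3 _ _))/evII.
- by apply: lin_sum => k _; apply/lin_scale/(lin_comp (Dop_linear _ _))/evII.
- by apply: lin_sum => k _; apply: lin_sum => l _; apply/lin_scale/lin_add; apply: evII.
by apply: lin_sum => k _; apply/lin_scale/evII.
Qed.

End Coboundary.

Section LieYamaguti.

Variable K : fieldType.

Record lieYamaguti := LieYamaguti {
  ly_space :> vectType K;
  bra : ly_space -> ly_space -> ly_space;
  tri : ly_space -> ly_space -> ly_space -> ly_space;
  bra_bilin : bilin bra;
  bra_alt : forall x, bra x x = 0;
  tri_trilin : trilin tri;
  tri_alt : forall x y, tri x x y = 0;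
  ly1 : forall x y z,
    bra (bra x y) z + bra (bra y z) x + bra (bra z x) y
    + tri x y z + tri y z x + tri z x y = 0;
  ly2 : forall x y z w,
    tri (bra x y) z w + tri (bra y z) x w + tri (bra z x) y w = 0;
  ly3 : forall x y z w,
    tri x y (bra z w) = bra (tri x y z) w + bra z (tri x y w);
  ly4 : forall x y z w t,
    tri x y (tri z w t)
    = tri (tri x y z) w t + tri z (tri x y w) t + tri z w (tri x y t)
}.

Definition ly_hom (g g' : lieYamaguti) (phi : 'Hom(g, g')) : Prop :=
  (forall x y, phi (bra x y) = bra (phi x) (phi y)) /\
  (forall x y z, phi (tri x y z) = tri (phi x) (phi y) (phi z)).

Record is_representation (g : lieYamaguti) (V : vectType K)
    (rho : g -> V -> V) (mu : g -> g -> V -> V) : Prop := IsRepresentation {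
  rep_rho_bilin : bilin rho;
  rep_mu_trilin : trilin mu;
  rep1 : forall x y z v,
    mu (bra x y) z v - mu x z (rho y v) + mu y z (rho x v) = 0;
  rep2 : forall x y z v,
    mu x (bra y z) v - rho y (mu x z v) + rho z (mu x y v) = 0;
  rep3 : forall x y z v,
    rho (tri x y z) v
    = Dop (@bra g) rho mu x y (rho z v) - rho z (Dop (@bra g) rho mu x y v);
  rep4 : forall x y z w v,
    mu z w (mu x y v) - mu y w (mu x z v) - mu x (tri y z w) v
    + Dop (@bra g) rho mu y z (mu x w v) = 0;
  rep5 : forall x y z w v,
    mu (tri x y z) w v + mu z (tri x y w) v
    = Dop (@bra g) rho mu x y (mu z w v) - mu z w (Dop (@bra g) rho mu x y v)
}.

Definition in_center (h : lieYamaguti) (x : h) : Prop :=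
  forall y z : h, [/\ bra x y = 0, tri x y z = 0 & tri y z x = 0].

Record ly_action (g h : lieYamaguti) := LYAction {
  rho : g -> h -> h;
  mu : g -> g -> h -> h;
  action_rep : is_representation rho mu;
  rho_center : forall x u, in_center (rho x u);
  mu_center : forall x y u, in_center (mu x y u);
  rho_bra : forall x u v, rho x (bra u v) = 0;
  mu_bra : forall x y u v, mu x y (bra u v) = 0;
  rho_tri : forall x u v w, rho x (tri u v w) = 0;
  mu_tri : forall x y u v w, mu x y (tri u v w) = 0
}.

Definition actD (g h : lieYamaguti) (A : ly_action g h) : g -> g -> h -> h :=
  Dop (@bra g) (rho A) (mu A).

Section RotaBaxter.

Variables (g h : lieYamaguti) (A : ly_action g h).

Local Notation rho := (rho A).
Local Notation mu := (mu A).
Local Notation D := (actD A).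

Definition descent_bra (T : 'Hom(h, g)) (u v : h) : h :=
  rho (T u) v - rho (T v) u + bra u v.

Definition descent_tri (T : 'Hom(h, g)) (u v w : h) : h :=
  D (T u) (T v) w + mu (T v) (T w) u - mu (T u) (T w) v + tri u v w.

Record relRB := RelRB {
  rb_map :> 'Hom(h, g);
  rb_bra : forall u v,
    bra (rb_map u) (rb_map v) = rb_map (descent_bra rb_map u v);
  rb_tri : forall u v w,
    tri (rb_map u) (rb_map v) (rb_map w) = rb_map (descent_tri rb_map u v w)
}.

Record relRB_hom (T' T : relRB) (psi_g : 'End(g)) (psi_h : 'End(h)) : Prop :=
  RelRBHom {
    hom_g : ly_hom psi_g;
    hom_h : ly_hom psi_h;
    hom_T : forall u, psi_g (T' u) = T (psi_h u);
    hom_rho : forall x u, psi_h (rho x u) = rho (psi_g x) (psi_h u);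
    hom_mu : forall x y u, psi_h (mu x y u) = mu (psi_g x) (psi_g y) (psi_h u)
  }.

Variable T : relRB.

Definition rhoT (u : h) (x : g) : g := bra (T u) x + T (rho x u).

Definition muT (u v : h) (x : g) : g :=
  tri x (T u) (T v) - T (D x (T u) v - mu x (T v) u).

Let lT : linear T. Proof. exact: linearP. Qed.
Let rho1 := (rep_rho_bilin (action_rep A)).1.
Let rho2 := (rep_rho_bilin (action_rep A)).2.
Let mu1 y v : linear (fun x => mu x y v).
Proof. by case: (rep_mu_trilin (action_rep A)). Qed.
Let mu2 x v : linear (fun y => mu x y v).
Proof. by case: (rep_mu_trilin (action_rep A)). Qed.
Let mu3 x y : linear (mu x y).
Proof. by case: (rep_mu_trilin (action_rep A)). Qed.
Let br1 (k : lieYamaguti) := (bra_bilin k).1.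
Let br2 (k : lieYamaguti) := (bra_bilin k).2.
Let tr1 (k : lieYamaguti) y z : linear (fun x : k => tri x y z).
Proof. by case: (tri_trilin k). Qed.
Let tr2 (k : lieYamaguti) x z : linear (fun y : k => tri x y z).
Proof. by case: (tri_trilin k). Qed.
Let tr3 (k : lieYamaguti) (x y : k) : linear (tri x y).
Proof. by case: (tri_trilin k). Qed.

Let D1 y v : linear (fun x => D x y v).
Proof.
rewrite /actD /Dop; apply: lin_add; last by apply/lin_opp/(lin_comp (rho1 v))/br1.
apply: lin_add; first by apply: lin_add; [exact: mu2 | exact/lin_opp/mu1].
by apply: lin_add; [exact: rho1 | exact/lin_opp/(lin_comp (rho2 y))].
Qed.

Let D2 x v : linear (fun y => D x y v).
Proof.
rewrite /actD /Dop; apply: lin_add; last by apply/lin_opp/(lin_comp (rho1 v))/br2.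
apply: lin_add; first by apply: lin_add; [exact: mu1 | exact/lin_opp/mu2].
by apply: lin_add; [exact: (lin_comp (rho2 x)) | exact/lin_opp/rho1].
Qed.

Let D3 x y : linear (D x y).
Proof.
rewrite /actD /Dop; apply: lin_add; last by apply/lin_opp/rho2.
apply: lin_add; first by apply: lin_add; [|apply: lin_opp]; apply: mu3.
by apply: lin_add; [|apply: lin_opp]; apply: lin_comp; apply: rho2.
Qed.

Let D0 x v : D x x v = 0.
Proof. by rewrite /actD /Dop bra_alt !subrr (lin0 (rho1 v)) subr0 addr0. Qed.

Fact descent_bra_bilin : bilin (descent_bra T).
Proof.
split=> [v|u]; rewrite /descent_bra.
  apply: lin_add; last exact: br1.
  by apply: lin_add; [exact: (lin_comp (rho1 v) lT) | exact/lin_opp/rho2].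
apply: lin_add; last exact: br2.
by apply: lin_add; [exact: rho2 | exact/lin_opp/(lin_comp (rho1 u) lT)].
Qed.

Fact descent_bra_alt u : descent_bra T u u = 0.
Proof. by rewrite /descent_bra subrr bra_alt addr0. Qed.

Fact descent_tri_trilin : trilin (descent_tri T).
Proof.
split=> [v w|u w|u v]; rewrite /descent_tri.
- apply: lin_add; last exact: tr1.
  apply: lin_add; last exact/lin_opp/(lin_comp (mu1 (T w) v) lT).
  by apply: lin_add; [exact: (lin_comp (D1 (T v) w) lT) | exact: mu3].
- apply: lin_add; last exact: tr2.
  apply: lin_add; last exact/lin_opp/mu3.
  apply: lin_add; first exact: (lin_comp (D2 (T u) w) lT).
  exact: (lin_comp (mu1 (T w) u) lT).
apply: lin_add; last exact: tr3.
apply: lin_add; last exact/lin_opp/(lin_comp (mu2 (T u) v) lT).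
by apply: lin_add; [exact: D3 | exact: (lin_comp (mu2 (T v) u) lT)].
Qed.

Fact descent_tri_alt u w : descent_tri T u u w = 0.
Proof. by rewrite /descent_tri D0 add0r subrr tri_alt addr0. Qed.

Fact rhoT_bilin : bilin rhoT.
Proof.
split=> [x|u]; rewrite /rhoT.
  by apply: lin_add; [exact: (lin_comp (br1 x) lT) | exact: (lin_comp lT (rho2 x))].
by apply: lin_add; [exact: br2 | exact: (lin_comp lT (rho1 u))].
Qed.

Fact muT_trilin : trilin muT.
Proof.
split=> [v x|u x|u v]; rewrite /muT.
- apply: lin_add; first exact: (lin_comp (tr2 x (T v)) lT).
  apply/lin_opp/(lin_comp lT)/lin_add; last exact/lin_opp/mu3.
  exact: (lin_comp (D2 x v) lT).
- apply: lin_add; first exact: (lin_comp (tr3 x (T u)) lT).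
  apply/lin_opp/(lin_comp lT)/lin_add; first exact: D3.
  exact/lin_opp/(lin_comp (mu2 x u) lT).
apply: lin_add; first exact: tr1.
by apply/lin_opp/(lin_comp lT)/lin_add; [exact: D1 | exact/lin_opp/mu1].
Qed.

Definition descent_data : lyData h g :=
  LyData descent_bra_bilin descent_bra_alt descent_tri_trilin descent_tri_alt
    rhoT_bilin muT_trilin.

Definition delta0_fun (x y : g) (v : h) : g := T (D x y v) - tri x y (T v).

Definition delta0 (w : wedge2 g) : 'Hom(h, g) :=
  wedge_lift (fun x y => linfun (delta0_fun x y)) w.

Lemma linfunE (V W : vectType K) (f : V -> W) : linear f -> linfun f =1 f.
Proof.
move=> lf; pose F : {linear V -> W} := HB.pack f (GRing.isLinear.Build K V W _ f lf).
exact: (lfunE F).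
Qed.

Lemma delta0E x y v : delta0 (wedge x y) v = T (D x y v) - tri x y (T v).
Proof.
have l3 p q : linear (delta0_fun p q).
  by apply: lin_add; [exact: (lin_comp lT) | exact/lin_opp/(lin_comp (tr3 p q) lT)].
rewrite /delta0 wedge_liftE ?linfunE //.
  split=> [q|p] a s t; apply/lfunP => u; rewrite add_lfunE scale_lfunE !linfunE //.
    set F := fun p => delta0_fun p q u; apply: (_ : linear F).
    by apply: lin_add; [exact: (lin_comp lT) | exact/lin_opp/tr1].
  set F := fun q => delta0_fun p q u; apply: (_ : linear F).
  by apply: lin_add; [exact: (lin_comp lT) | exact/lin_opp/tr2].
move=> p; apply/lfunP => u; rewrite linfunE // zero_lfunE /delta0_fun.
by rewrite D0 tri_alt (lin0 lT) subr0.
Qed.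

End RotaBaxter.

Definition cochain (h g : vectType K) (n : nat) : lmodType K :=
  match n with
  | 0 => wedge2 g
  | 1 => 'Hom(h, g)
  | m.+2 => (cochainI m.+1 h g * cochainII m.+1 h g)%type
  end.

Section Cohomology.

Variables (g h : lieYamaguti) (A : ly_action g h) (T : relRB A).

Definition delta (n : nat) : cochain h g n -> cochain h g n.+1 :=
  match n with
  | 0 => delta0 T
  | 1 => delta1 (descent_data T)
  | m.+2 => @deltaS _ _ _ (descent_data T) m.+1
  end.

Fact delta_linear n : linear (@delta n).
Proof.
case: n => [|[|n]].
- exact: wedge_lift_linear.
- exact: delta1_linear.
exact: deltaS_linear.
Qed.

HB.instance Definition _ n :=
  GRing.isLinear.Build K (cochain h g n) (cochain h g n.+1) _ (@delta n)
    (@delta_linear n).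

(* Z^(n+1), H^(n+1) and the projection between them. *)
Definition cocycleS (n : nat) : lmodType K := cocycle (@delta n.+1).
Definition cohomologyS (n : nat) : lmodType K :=
  homology (@delta n) (@delta n.+1).
Definition cohomologyS_class n : cocycleS n -> cohomologyS n :=
  @homology_class _ _ _ _ (@delta n) (@delta n.+1).

End Cohomology.

Section CochainMap.

Variables (g h : vectType K) (psi_g : 'End(g)) (psi_h : 'End(h)).

Definition pull n (U : 'I_n -> h * h) : 'I_n -> h * h :=
  fun i => ((psi_h^-1)%VF (U i).1, (psi_h^-1)%VF (U i).2).

Definition pI_raw n (f : cochainI n h g) (U : 'I_n -> h * h) : g :=
  psi_g (f (pull U)).

Definition pII_raw n (f : cochainII n h g) (U : 'I_n -> h * h) (v : h) : g :=
  psi_g (f (pull U) ((psi_h^-1)%VF v)).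

Let pull_bialt n (f : ('I_n -> h * h) -> g) :
  multialt f -> multialt (fun U => psi_g (f (pull U))).
Proof.
move=> mf U i; have [f1 f2 f0] := mf (pull U) i.
have lg : linear psi_g by exact: linearP.
have lh : linear (psi_h^-1)%VF by exact: linearP.
pose F x := psi_g (f (upd (pull U) i ((psi_h^-1)%VF x.1, (psi_h^-1)%VF x.2))).
apply: (@bialt_ext _ _ _ _ F) => [x|].
  by congr (psi_g (f _)); apply/funext => j; rewrite /pull /upd; case: eqP.
rewrite /F; split=> [v|u|u] /=.
- exact: (lin_comp lg (lin_comp (f1 _) lh)).
- exact: (lin_comp lg (lin_comp (f2 _) lh)).
by rewrite f0 linear0.
Qed.

Fact pI_subproof n (f : cochainI n h g) : pI_raw f \in @cochainI_pred K n h g.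
Proof. exact/asboolP/pull_bialt/cochainIP. Qed.

Fact pII_subproof n (f : cochainII n h g) : pII_raw f \in @cochainII_pred K n h g.
Proof.
apply/asboolP; split=> [w|U]; rewrite /pII_raw.
  by apply: (pull_bialt (f := fun U => f U _)); apply: cochainIIP.
have lg : linear psi_g by exact: linearP.
have lh : linear (psi_h^-1)%VF by exact: linearP.
exact: (lin_comp lg (lin_comp (cochainII_linear f _) lh)).
Qed.

(* The map p in degree n + 1. *)
Definition pmapS (n : nat) : cochain h g n.+1 -> cochain h g n.+1 :=
  match n with
  | 0 => fun f => (psi_g \o f \o psi_h^-1)%VF
  | m.+1 => fun c => (CochainI (pI_subproof c.1), CochainII (pII_subproof c.2))
  end.

End CochainMap.

End LieYamaguti.

Arguments bra {K g} : rename.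
Arguments tri {K g} : rename.

(* Main.v *)
Require Import Defs.
From HB Require Import structures.
From mathcomp Require Import all_boot all_algebra.
From mathcomp Require Import boolp.

Set Implicit Arguments.
Unset Strict Implicit.
Unset Printing Implicit Defensive.

Import GRing.Theory.
Local Open Scope ring_scope.

(** The coboundary operator [delta T] in positive degrees is written with four
    multilinear maps only: the descent brackets of [T] on [h] and the
    representation [rhoT], [muT] on [g].  A homomorphism [(psi_g, psi_h)] from
    [T'] to [T] carries each of these maps for [T'] to the corresponding one for
    [T] ([descent_dataM]), and hence also the operator [D] built from them
    ([Dop_morph]).  Let [phi] be the inverse of [psi_h].  Every term of
    [delta T' c], evaluated at arguments pulled back along [phi] and then mapped
    by [psi_g], therefore becomes the same term of [delta T] for the cochain
    [p c]; this gives [p \o delta T' = delta T \o p] term by term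
    ([pmapS_delta1], [pmapS_deltaS]).

    On cohomology, [p] preserves cocycles because it commutes with the
    coboundary, and a linear map that preserves cocycles and coboundaries
    descends to the quotient ([homology_map]).  In degree at least 2 the
    coboundaries are again handled by commutation; in degree 1 they come from
    bivectors of [g], where [p] is not defined, and one uses instead that
    [p (delta0 T' (x /\ y)) = delta0 T (psi_g x /\ psi_g y)]
    ([pmapS_delta0]). *)

(** * Functoriality of homology *)

(** The sources of [d] and [d'] are not linked by a map: the quotient sees only
    the images of [d] and [d'], and in the application [p] has no component
    between bivectors. *)
Lemma homology_map (K : fieldType) (U V W U' V' W' : lmodType K)
    (d : {linear U -> V}) (e : {linear V -> W})
    (d' : {linear U' -> V'}) (e' : {linear V' -> W'}) (F : V -> V') :
    linear F -> (forall v, e v = 0 -> e' (F v) = 0) ->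
    (forall u, exists u', d' u' = F (d u)) ->
  exists Fstar : {linear homology d e -> homology d' e'},
    forall z : cocycle e, exists z' : cocycle e',
      cocycle_val z' = F (cocycle_val z) /\
      Fstar (homology_class d z) = homology_class d' z'.
Proof.
move=> lF Fe Fd.
pose LF : {linear V -> V'} := HB.pack F (GRing.isLinear.Build K V V' _ F lF).
have FP (z : cocycle e) : F (cocycle_val z) \in cocycle_pred e'.
  by apply/eqP/Fe/eqP/(valP z).
pose Fz z : cocycle e' := Cocycle (FP z).
have Fz_lin : linear Fz by move=> a x y; apply/val_inj; rewrite /= lF.
have FzD x y : F (val x - val y) = val (Fz x) - val (Fz y).
  by rewrite -[LHS]/(LF _) linearB.
have class_Fz x y : homology_class d x = homology_class d y ->
    homology_class d' (Fz x) = homology_class d' (Fz y).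
  move=> /eqP/homology_classP[u du]; apply/eqP/homology_classP.
  by have [u' du'] := Fd u; exists u'; rewrite du' du FzD.
pose G (x : homology d e) : homology d' e' := homology_class d' (Fz (repr x)).
have GE z : G (homology_class d z) = homology_class d' (Fz z).
  by apply: class_Fz; rewrite /homology_class reprK.
have lG : linear G.
  move=> a; elim/homology_ind => x; elim/homology_ind => y.
  by rewrite -linearP !GE Fz_lin linearP.
pose Fstar : {linear homology d e -> homology d' e'} :=
  HB.pack G (GRing.isLinear.Build K (homology d e) (homology d' e') _ G lG).
by exists Fstar => z; exists (Fz z); split=> //; exact: GE.
Qed.

(** * Naturality of the coboundary in the multilinear data *)

Record lyData_morph (K : fieldType) (h g : vectType K) (A' A : lyData h g)
    (psi_g : 'End(g)) (psi_h : 'End(h)) : Prop := LyDataMorph {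
  morph_br : forall u v, psi_h (d_br A' u v) = d_br A (psi_h u) (psi_h v);
  morph_tr : forall u v w,
    psi_h (d_tr A' u v w) = d_tr A (psi_h u) (psi_h v) (psi_h w);
  morph_rho : forall u x, psi_g (d_rho A' u x) = d_rho A (psi_h u) (psi_g x);
  morph_mu : forall u v x,
    psi_g (d_mu A' u v x) = d_mu A (psi_h u) (psi_h v) (psi_g x)
}.

(** [D] is built by sums and composition from the bracket, [rho] and [mu], so it
    is carried along with them.  The spaces are left arbitrary because this is
    used both for [D] acting on [h] (the action) and for [D] acting on [g] (the
    representation of the descent algebra). *)
Lemma Dop_morph (K : fieldType) (V V' W W' : lmodType K)
    (br : V -> V -> V) (rho : V -> W -> W) (mu : V -> V -> W -> W)
    (br' : V' -> V' -> V') (rho' : V' -> W' -> W') (mu' : V' -> V' -> W' -> W')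
    (psi : V -> V') (F : {linear W -> W'}) :
    (forall u v, psi (br u v) = br' (psi u) (psi v)) ->
    (forall u x, F (rho u x) = rho' (psi u) (F x)) ->
    (forall u v x, F (mu u v x) = mu' (psi u) (psi v) (F x)) ->
  forall u v x,
    F (Dop br rho mu u v x) = Dop br' rho' mu' (psi u) (psi v) (F x).
Proof.
by move=> brM rhoM muM u v x; rewrite /Dop !(linearB, linearD) !(brM, rhoM, muM).
Qed.

Section Naturality.

Context (K : fieldType) (h g : vectType K) (A' A : lyData h g).
Context (psi_g : 'End(g)) (psi_h : 'End(h)).
Context (psiM : lyData_morph A' A psi_g psi_h) (psi_h_inv : bijective psi_h).

Local Notation phi := (psi_h^-1)%VF.
Local Notation D' := (Dop (d_br A') (d_rho A') (d_mu A')).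
Local Notation D := (Dop (d_br A) (d_rho A) (d_mu A)).

Let psiK : cancel psi_h phi.
Proof. by apply: lker0_lfunK; apply/lker0P/bij_inj. Qed.

Let phiK : cancel phi psi_h. Proof. by apply/(bij_can_sym psi_h_inv). Qed.

Let phi_br u v : d_br A' (phi u) (phi v) = phi (d_br A u v).
Proof. by apply: (can_inj psiK); rewrite (morph_br psiM) !phiK. Qed.

Let phi_tr u v w : d_tr A' (phi u) (phi v) (phi w) = phi (d_tr A u v w).
Proof. by apply: (can_inj psiK); rewrite (morph_tr psiM) !phiK. Qed.

Let psi_rho u x : psi_g (d_rho A' (phi u) x) = d_rho A u (psi_g x).
Proof. by rewrite (morph_rho psiM) phiK. Qed.

Let psi_mu u v x : psi_g (d_mu A' (phi u) (phi v) x) = d_mu A u v (psi_g x).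
Proof. by rewrite (morph_mu psiM) !phiK. Qed.

Let psi_D u v x : psi_g (D' (phi u) (phi v) x) = D u v (psi_g x).
Proof.
by rewrite (Dop_morph (morph_br psiM) (morph_rho psiM) (morph_mu psiM)) !phiK.
Qed.

Lemma pmapS_delta1 (f : 'Hom(h, g)) :
  pmapS psi_g psi_h (n := 1) (delta1 A' f)
  = delta1 A (pmapS psi_g psi_h (n := 0) f).
Proof.
congr pair; apply/val_inj/funext => U /=.
  rewrite /pI_raw /= /delta1_I_raw /= !linearB /= !comp_lfunE.
  by rewrite !psi_rho phi_br.
apply/funext => w; rewrite /pII_raw /= /delta1_II_raw /=.
rewrite linearB linearB linearD /= !comp_lfunE.
by rewrite psi_D !psi_mu phi_tr.
Qed.

Let circ1_pull n (U : 'I_n.+1 -> h * h) k l :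
  circ1 A' (pull psi_h U) k l = pull psi_h (circ1 A U k l).
Proof.
apply/funext => j; rewrite /circ1 /pull /hat /upd.
by case: eqP => //= _; rewrite phi_tr.
Qed.

Let circ2_pull n (U : 'I_n.+1 -> h * h) k l :
  circ2 A' (pull psi_h U) k l = pull psi_h (circ2 A U k l).
Proof.
apply/funext => j; rewrite /circ2 /pull /hat /upd.
by case: eqP => //= _; rewrite phi_tr.
Qed.

(* Linearity of [psi_g] alone: the generic lemmas would also distribute the
   signs [(-1) ^+ k] over the differences inside the coboundary. *)
Let psi_gD : {morph psi_g : x y / x + y}. Proof. exact: linearD. Qed.
Let psi_gB : {morph psi_g : x y / x - y}. Proof. exact: linearB. Qed.
Let psi_gZ a : {morph psi_g : x / a *: x}. Proof. by move=> x; rewrite linearZ. Qed.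
Let psi_g_sum (I : finType) (P : pred I) (F : I -> g) :
  psi_g (\sum_(i | P i) F i) = \sum_(i | P i) psi_g (F i).
Proof. exact: linear_sum. Qed.

Lemma pmapS_deltaS n (c : cochain h g n.+2) :
  pmapS psi_g psi_h (n := n.+2) (deltaS A' c)
  = deltaS A (pmapS psi_g psi_h (n := n.+1) c).
Proof.
case: c => f p; congr pair; apply/val_inj/funext => U /=.
  rewrite /pI_raw /= /delta_I_raw !psi_gD /=; congr (_ + _ + _).
  - by rewrite psi_gZ /= !psi_gB !psi_rho phi_br.
  - by rewrite psi_g_sum; apply: eq_bigr => k _; rewrite psi_gZ /= psi_D.
  rewrite psi_g_sum; apply: eq_bigr => k _.
  rewrite psi_g_sum; apply: eq_bigr => l _.
  by rewrite psi_gZ /= psi_gD circ1_pull circ2_pull.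
apply/funext => w; rewrite /pII_raw /= /delta_II_raw !psi_gD /=.
congr (_ + _ + _ + _).
- by rewrite psi_gZ /= psi_gB !psi_mu.
- by rewrite psi_g_sum; apply: eq_bigr => k _; rewrite psi_gZ /= psi_D.
- rewrite psi_g_sum; apply: eq_bigr => k _.
  rewrite psi_g_sum; apply: eq_bigr => l _.
  by rewrite psi_gZ /= psi_gD circ1_pull circ2_pull.
by rewrite psi_g_sum; apply: eq_bigr => k _; rewrite psi_gZ /= phi_tr.
Qed.

End Naturality.

(** * Homomorphisms of relative Rota-Baxter operators *)

Section RotaBaxterHom.

Context (K : fieldType) (g h : lieYamaguti K) (A : ly_action g h).
Context (T T' : relRB A) (psi_g : 'End(g)) (psi_h : 'End(h)).
Context (psi_hom : relRB_hom T' T psi_g psi_h).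

Lemma actD_hom x y u :
  psi_h (actD A x y u) = actD A (psi_g x) (psi_g y) (psi_h u).
Proof.
exact: (Dop_morph (hom_g psi_hom).1 (hom_rho psi_hom) (hom_mu psi_hom)).
Qed.

(** The descent brackets and [rhoT], [muT] are expressions in [T], the action
    and the brackets of [g] and [h], each of which the pair [(psi_g, psi_h)]
    respects. *)
Lemma descent_dataM :
  lyData_morph (descent_data T') (descent_data T) psi_g psi_h.
Proof.
have [[gbr gtr] [hbr htr] homT homR homM] := psi_hom.
split=> [u v|u v w|u x|u v x] /=.
- by rewrite /descent_bra linearD linearB /= hbr !homR !homT.
- rewrite /descent_tri linearD linearB linearD /= htr actD_hom !homM.
  by rewrite !homT.
- by rewrite /rhoT linearD /= gbr !homT homR.
by rewrite /muT linearB /= gtr !homT linearB /= actD_hom homM !homT.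
Qed.

Hypothesis psi_h_inv : bijective psi_h.

Lemma pmapS_delta n (c : cochain h g n.+1) :
  pmapS psi_g psi_h (delta T' c) = delta T (pmapS psi_g psi_h c).
Proof.
case: n c => [|n] c; first exact: (pmapS_delta1 descent_dataM).
exact: (pmapS_deltaS descent_dataM).
Qed.

(** Both terms [T (D x y v)] and [tri x y (T v)] of the coboundary of a bivector
    are natural, so [p] turns it into the coboundary of the image bivector. *)
Lemma pmapS_delta0 x y :
  pmapS psi_g psi_h (n := 0) (delta0 T' (wedge x y))
  = delta0 T (wedge (psi_g x) (psi_g y)).
Proof.
have psiK : cancel psi_h (psi_h^-1)%VF.
  by apply: lker0_lfunK; apply/lker0P/bij_inj.
have phiK : cancel (psi_h^-1)%VF psi_h by apply/(bij_can_sym psi_h_inv).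
have [[_ gtr] _ homT _ _] := psi_hom.
apply/lfunP => v; rewrite /= !comp_lfunE !delta0E linearB /= homT actD_hom.
by rewrite gtr homT phiK.
Qed.

End RotaBaxterHom.

(** * The cochain map and its effect on coboundaries *)

Lemma pI_raw_linear (K : fieldType) (g h : vectType K)
    (psi_g : 'End(g)) (psi_h : 'End(h)) n (U : 'I_n -> h * h) :
  linear (fun f : cochainI n h g => pI_raw psi_g psi_h f U).
Proof.
by move=> a f f'; rewrite /pI_raw /= linearD linearZ.
Qed.

Lemma pII_raw_linear (K : fieldType) (g h : vectType K)
    (psi_g : 'End(g)) (psi_h : 'End(h)) n (U : 'I_n -> h * h) v :
  linear (fun p : cochainII n h g => pII_raw psi_g psi_h p U v).
Proof.
by move=> a p p'; rewrite /pII_raw /= linearD linearZ.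
Qed.

Lemma pmapS_linear (K : fieldType) (g h : vectType K)
    (psi_g : 'End(g)) (psi_h : 'End(h)) n :
  linear (@pmapS K g h psi_g psi_h n).
Proof.
case: n => [|n] a x y; last first.
  congr pair; apply/val_inj/funext => U.
    exact: (pI_raw_linear psi_g psi_h U a x.1 y.1).
  apply/funext => w; exact: (pII_raw_linear psi_g psi_h U w a x.2 y.2).
by rewrite /= comp_lfunDr -comp_lfunZr comp_lfunDl -comp_lfunZl.
Qed.

Lemma linear_wedge_lift (K : fieldType) (V : vectType K) (W X : lmodType K)
    (L : W -> X) (b : V -> V -> W) (u : wedge2 V) :
  linear L -> L (wedge_lift b u) = wedge_lift (fun x y => L (b x y)) u.
Proof.
move=> lL.
pose F : {linear W -> X} := HB.pack L (GRing.isLinear.Build K W X _ L lL).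
rewrite -[L]/(F : W -> X) /wedge_lift linear_sum.
by apply: eq_bigr => p _; rewrite linearZ.
Qed.

(** In degree 1 a preimage of [p (delta0 T' u)] is the image of [u] under the
    map that [psi_g] induces on bivectors.  Decomposable bivectors span, so
    [pmapS_delta0] and linearity suffice. *)
Lemma pmapS_coboundary (K : fieldType) (g h : lieYamaguti K)
    (A : ly_action g h) (T T' : relRB A) (psi_g : 'End(g)) (psi_h : 'End(h)) :
    relRB_hom T' T psi_g psi_h -> bijective psi_h ->
  forall n (u : cochain h g n), exists u' : cochain h g n,
    delta T u' = pmapS psi_g psi_h (delta T' u).
Proof.
move=> psi_hom psi_h_inv [|n] u; last first.
  by exists (pmapS psi_g psi_h u); rewrite -(pmapS_delta psi_hom).
exists (wedge_lift (fun x y => wedge (psi_g x) (psi_g y)) u).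
rewrite (linear_wedge_lift _ _ (delta_linear T (n := 0))).
rewrite -[in RHS](wedge_span u).
rewrite (linear_wedge_lift _ _ (lin_comp (@pmapS_linear _ _ _ psi_g psi_h 0)
  (delta_linear T' (n := 0)))).
by apply: eq_bigr => p _; rewrite /= -(pmapS_delta0 psi_hom).
Qed.

Theorem theorem5p7 (K : fieldType) (charK0 : [pchar K] =i pred0)
    (g h : lieYamaguti K) (A : ly_action g h) (T T' : relRB A)
    (psi_g : 'End(g)) (psi_h : 'End(h))
    (psi_hom : relRB_hom T' T psi_g psi_h) (psi_h_inv : bijective psi_h) :
  [/\ (* p is linear in every degree n + 1 >= 1 *)
      forall n : nat, linear (@pmapS K g h psi_g psi_h n),
      (* p commutes with the coboundary operators of T' and T *)
      forall (n : nat) (c : cochain h g n.+1),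
        pmapS psi_g psi_h (delta T' c) = delta T (pmapS psi_g psi_h c)
      (* p induces a linear map p_* from H^(n+1) of T' to H^(n+1) of T *)
    & forall n : nat,
        exists pstar : {linear cohomologyS T' n -> cohomologyS T n},
        forall z' : cocycleS T' n,
        exists z : cocycleS T n,
          cocycle_val z = pmapS psi_g psi_h (cocycle_val z')
          /\ pstar (cohomologyS_class z') = cohomologyS_class z].
Proof.
have pL n := @pmapS_linear K g h psi_g psi_h n.
have p_delta := pmapS_delta psi_hom psi_h_inv.
split=> // n.
apply: (homology_map (pL n)) => [c c0|u].
  apply: etrans (esym (p_delta n c)) _; apply: etrans (congr1 _ c0) _.
  exact: (lin0 (pL n.+1)).
exact: pmapS_coboundary.
Qed.
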